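(* Let $(M,g)$ be a Riemannian manifold of dimension $n$. (1) For any real numbers $k,l$ with $0<k<l<n$: $\mathrm{Ein}_l>0 \Rightarrow \mathrm{Ein}_k>0 \Rightarrow \mathrm{Scal}>0$. (2) For any real numbers $k,l$ with $k<l<0$: $\mathrm{Ein}_k>0 \Rightarrow \mathrm{Ein}_l>0 \Rightarrow \mathrm{Scal}>0$.
   Context: $\mathrm{Ric}$ and $\mathrm{Scal}$ denote the Ricci tensor and scalar curvature of $g$. For a real constant $k$, the modified Einstein tensor is $\mathrm{Ein}_k:=\mathrm{Scal}\cdot g-k\,\mathrm{Ric}$. $\mathrm{Ein}_k>0$ means that this symmetric $2$-tensor is positive definite at every point of $M$; $\mathrm{Scal}>0$ means positive at every point. *)

(* Defs.v *)
From HB Require Import structures.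
From mathcomp Require Import all_boot all_order all_algebra.
From mathcomp Require Import all_classical all_reals all_analysis.

Set Implicit Arguments.
Unset Strict Implicit.
Unset Printing Implicit Defensive.

Import Order.TTheory GRing.Theory Num.Theory.
Import numFieldNormedType.Exports.

Local Open Scope classical_set_scope.
Local Open Scope ring_scope.

(* Partial derivatives are directional derivatives along the standard basis
   vectors of 'rV[R]_n. *)
Definition partial (R : realType) (n : nat) (i : 'I_n)
    (f : 'rV[R]_n -> R) (x : 'rV[R]_n) : R :=
  'D_(delta_mx 0 i) f x.

(* f is C^k on U.  Functions are total; U is open in every use below, so that
   continuity and derivability at the points of U only involve the values of f
   on U. *)
Fixpoint Ck_on (R : realType) (n k : nat) (U : set 'rV[R]_n)
    (f : 'rV[R]_n -> R) {struct k} : Prop :=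
  (forall x, U x -> {for x, continuous f}) /\
  (if k is k'.+1 then
     forall i : 'I_n,
       (forall x, U x -> derivable f x (delta_mx 0 i)) /\
       Ck_on k' U (partial i f)
   else True).

Definition smooth_on (R : realType) (n : nat) (U : set 'rV[R]_n)
    (f : 'rV[R]_n -> R) : Prop :=
  forall k, Ck_on k U f.

(* A chart is a homeomorphism from the open set [dom] onto an open subset of
   R^n, with inverse [param]; both maps are total, with arbitrary values
   outside [dom] and its image. *)
Record chart (R : realType) (n : nat) (T : topologicalType) := Chart {
  dom : set T;
  coord : T -> 'rV[R]_n;
  param : 'rV[R]_n -> T;
  dom_open : open dom;
  img_open : open (coord @` dom);
  coordK : forall p, dom p -> param (coord p) = p;
  coord_continuous : forall p, dom p -> {for p, continuous coord};
  param_continuous :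
    forall x, (coord @` dom) x -> {for x, continuous param}
}.

Definition img (R : realType) (n : nat) (T : topologicalType)
    (c : chart R n T) : set 'rV[R]_n := coord c @` dom c.

Definition overlap (R : realType) (n : nat) (T : topologicalType)
    (c c' : chart R n T) : set 'rV[R]_n := coord c @` (dom c `&` dom c').

Definition transition (R : realType) (n : nat) (T : topologicalType)
    (c c' : chart R n T) (x : 'rV[R]_n) : 'rV[R]_n := coord c' (param c x).

(* [atlas] need not be maximal. *)
Record smoothManifold (R : realType) (n : nat) := SmoothManifold {
  carrier :> topologicalType;
  atlas : set (chart R n carrier);
  carrier_hausdorff : hausdorff_space carrier;
  carrier_second_countable : @second_countable carrier;
  atlas_cover : forall p, exists2 c, atlas c & dom c p;
  atlas_smooth : forall c c', atlas c -> atlas c' ->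
    forall j : 'I_n, smooth_on (overlap c c') (fun x => transition c c' x 0 j)
}.

Definition posdefmx (R : realType) (n : nat) (A : 'M[R]_n) : Prop :=
  forall v : 'rV[R]_n, v != 0 -> 0 < (v *m A *m v^T) 0 0.

(* [metric c x] is the matrix (g_ij) in the chart c at the point with
   coordinates x.  With the row-vector convention of 'J, the entry (i, j) of
   'J f x is the i-th partial derivative of the j-th component of f, so that
   [metric_tensor] is the transformation law of a covariant 2-tensor. *)
Record riemannianMetric (R : realType) (n : nat) (M : smoothManifold R n) :=
  RiemannianMetric {
  metric : chart R n M -> 'rV[R]_n -> 'M[R]_n;
  metric_sym : forall c, atlas c -> forall x, img c x ->
    (metric c x)^T = metric c x;
  metric_pos : forall c, atlas c -> forall x, img c x -> posdefmx (metric c x);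
  metric_smooth : forall c, atlas c -> forall i j : 'I_n,
    smooth_on (img c) (fun x => metric c x i j);
  metric_tensor : forall c c', atlas c -> atlas c' ->
    forall x, overlap c c' x ->
    metric c x = 'J (transition c c') x *m metric c' (transition c c' x)
                 *m ('J (transition c c') x)^T
}.

Section LocalCurvature.
Variables (R : realType) (n : nat).
Variable G : 'rV[R]_n -> 'M[R]_n.
Implicit Types (x : 'rV[R]_n) (a b c d : 'I_n).

(* Gamma^a_bc of the Levi-Civita connection. *)
Definition christoffel a b c x : R :=
  2^-1 * \sum_(e < n) invmx (G x) a e *
    (partial b (fun y => G y e c) x + partial c (fun y => G y e b) x
     - partial e (fun y => G y b c) x).

(* R^a_bcd, where R(d_c, d_d) d_b = \sum_a R^a_bcd d_a and
   R(X, Y) = [nabla_X, nabla_Y] - nabla_[X, Y]. *)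
Definition riemann a b c d x : R :=
  partial c (christoffel a d b) x - partial d (christoffel a c b) x
  + \sum_(e < n) (christoffel a c e x * christoffel e d b x
                  - christoffel a d e x * christoffel e c b x).

(* With these signs the round spheres have positive Ricci curvature. *)
Definition ricci_mx x : 'M[R]_n :=
  \matrix_(b, d) \sum_(a < n) riemann a b a d x.

Definition scalar_curvature x : R :=
  \sum_(i < n) \sum_(j < n) invmx (G x) i j * ricci_mx x i j.

End LocalCurvature.

Section ModifiedEinstein.
Variables (R : realType) (n : nat) (M : smoothManifold R n).
Variable g : riemannianMetric M.

(* Ric, Scal and Ein_k at the point p, expressed in the chart c around p. *)
Definition Ric (c : chart R n M) (p : M) : 'M[R]_n :=
  ricci_mx (metric g c) (coord c p).

Definition Scal (c : chart R n M) (p : M) : R :=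
  scalar_curvature (metric g c) (coord c p).

Definition Ein (k : R) (c : chart R n M) (p : M) : 'M[R]_n :=
  Scal c p *: metric g c (coord c p) - k *: Ric c p.

(* Ric and Ein_k are tensors and Scal is a function on M, so the conditions
   below at p do not depend on the chart of the atlas chosen around p. *)
Definition Ein_gt0 (k : R) : Prop :=
  forall (c : chart R n M) (p : M), atlas c -> dom c p -> posdefmx (Ein k c p).

Definition Scal_gt0 : Prop :=
  forall (c : chart R n M) (p : M), atlas c -> dom c p -> 0 < Scal c p.

End ModifiedEinstein.

(* Main.v *)
Require Import Defs.
From mathcomp Require Import all_boot all_order all_algebra.
From mathcomp Require Import all_classical all_reals all_analysis.
From mathcomp Require Import ring.

Set Implicit Arguments.
Unset Strict Implicit.
Unset Printing Implicit Defensive.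

Import Order.TTheory GRing.Theory Num.Theory.

Local Open Scope ring_scope.

(** Taking the [g]-trace of [Ein_k] gives [(n - k) * Scal], and the trace of a
    positive definite form with respect to a positive definite form is
    positive; hence [Ein_k > 0] forces [Scal > 0] whenever [k < n].  The
    remaining implications hold because, for [0 < t < 1],
    [Ein_(t * l) = t * Ein_l + (1 - t) * Scal * g] is then a positive
    combination of positive definite forms. *)

Lemma posdefmx_congr (R : realType) (n : nat) (A P : 'M[R]_n) :
  P \in unitmx -> posdefmx A -> posdefmx (P *m A *m P^T).
Proof.
move=> Pu pA v v0.
have -> : v *m (P *m A *m P^T) *m v^T = (v *m P) *m A *m (v *m P)^T.
  by rewrite trmx_mul !mulmxA.
apply: pA; apply: contraNneq v0 => vP0.
by rewrite -(mulmxK Pu v) vP0 mul0mx.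
Qed.

Lemma posdefmx_comb (R : realType) (n : nat) (A B : 'M[R]_n) (a b : R) :
  0 < a -> 0 < b -> posdefmx A -> posdefmx B -> posdefmx (a *: A + b *: B).
Proof.
move=> a0 b0 pA pB v v0.
rewrite mulmxDr mulmxDl -!scalemxAr -!scalemxAl.
rewrite mxE [X in X + _]mxE [X in _ + X]mxE.
by apply: addr_gt0; apply: mulr_gt0 => //; [exact: pA | exact: pB].
Qed.

Lemma posdefmx_block_diag (R : realType) (m n : nat) (A : 'M[R]_m)
    (B : 'M[R]_n) :
  posdefmx (block_mx A 0 0 B) -> posdefmx A /\ posdefmx B.
Proof.
move=> pAB; split=> v v0.
- have := pAB (row_mx v 0).
  rewrite mul_row_block tr_row_mx mul_row_col !mul0mx !mulmx0 !(addr0, add0r).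
  rewrite trmx0 !mulmx0 addr0; apply.
  by apply: contraNneq v0 => /(congr1 lsubmx); rewrite row_mxKl linear0 => ->.
- have := pAB (row_mx 0 v).
  rewrite mul_row_block tr_row_mx mul_row_col !mul0mx !mulmx0 !(addr0, add0r).
  rewrite trmx0 !mulmx0 add0r; apply.
  by apply: contraNneq v0 => /(congr1 rsubmx); rewrite row_mxKr linear0 => ->.
Qed.

Lemma posdefmx_diag_gt0 (R : realType) (n : nat) (A : 'M[R]_n) (i : 'I_n) :
  posdefmx A -> 0 < A i i.
Proof.
move=> /(_ (delta_mx 0 i)); rewrite -rowE trmx_delta -colE !mxE; apply.
apply/eqP => /matrixP /(_ 0 i); rewrite !mxE !eqxx => /eqP.
by rewrite oner_eq0.
Qed.

(** Symmetric Gaussian elimination, by induction on [n]: the positive corner entry serves as pivot,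
    and the Schur complement left after clearing its row and column is again symmetric and positive
    definite. The rows of [P] form an orthonormal basis for the form [A]. *)
Lemma posdefmx_congr1 (R : realType) (n : nat) (A : 'M[R]_n) :
  A^T = A -> posdefmx A -> exists P : 'M[R]_n, P *m A *m P^T = 1%:M.
Proof.
elim: n A => [|n IHn] A sA pA.
  by exists 0; apply/matrixP => -[].
rewrite -[n.+1]/(1 + n)%N in A sA pA *.
pose a : R := A 0 0; have a0 : 0 < a by exact: posdefmx_diag_gt0.
have eul : ulsubmx A = a%:M.
  by rewrite [LHS]mx11_scalar !mxE; congr (A _ _)%:M; apply: val_inj.
have [sur sdr] : (ursubmx A)^T = dlsubmx A /\ (drsubmx A)^T = drsubmx A.
  by rewrite -{2 4}sA trmx_ursub trmx_drsub.
(* The first step of Gaussian elimination, performed on rows and columns. *)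
pose L : 'M[R]_(1 + n) := block_mx 1%:M 0 (- a^-1 *: dlsubmx A) 1%:M.
pose S := - a^-1 *: (dlsubmx A *m ursubmx A) + drsubmx A.
have LAL : L *m A *m L^T = block_mx a%:M 0 0 S.
  rewrite -[A in L *m A]submxK /L eul tr_block_mx !mulmx_block.
  rewrite !trmx1 !trmx0 !linearZ /= -sur trmxK.
  rewrite !(mul1mx, mulmx1, mul0mx, mulmx0, addr0, add0r).
  rewrite mul_mx_scalar mul_scalar_mx -!scalemxAl !scalerA.
  rewrite mulNr mulrN mulVf ?mulfV ?gt_eqF // !scaleN1r !addNr mul0mx.
  by rewrite scaler0 add0r /S -sur.
have Lu : L \in unitmx by rewrite unitmxE det_lblock !det1 mulr1 unitr1.
have [_ pS] : posdefmx (a%:M : 'M[R]_1) /\ posdefmx S.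
  by apply: posdefmx_block_diag; rewrite -LAL; exact: posdefmx_congr.
have sS : S^T = S.
  by rewrite /S linearD /= linearZ /= trmx_mul sdr -sur trmxK.
have [P PSP] := IHn S sS pS.
(* Scaling by the inverse of [Num.sqrt a] normalizes the pivot, while the [P] of the induction
   hypothesis reduces the Schur complement [S]. *)
exists (block_mx (Num.sqrt a)^-1%:M 0 0 P *m L).
rewrite trmx_mul !mulmxA -[_ *m L *m A]mulmxA -[_ *m (L *m A) *m _]mulmxA LAL.
rewrite tr_block_mx !mulmx_block !trmx0 !(mul0mx, mulmx0, addr0, add0r) PSP.
rewrite tr_scalar_mx -!scalar_mxM -[X in _ * X * _](sqr_sqrtr (ltW a0)).
by rewrite expr2 mulKf ?mulfV -?scalar_mx_block // gt_eqF // sqrtr_gt0.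
Qed.

(* [B] need not be symmetric: writing [A^-1 = P^T P], the sum is the sum of the
   values of the form [B] on the rows of [P]. *)
Lemma posdefmx_trace_gt0 (R : realType) (n : nat) (A B : 'M[R]_n) :
  (0 < n)%N -> A^T = A -> posdefmx A -> posdefmx B ->
  0 < \sum_(i < n) \sum_(j < n) invmx A i j * B i j.
Proof.
move=> n0 sA pA pB.
have [P PAP] := posdefmx_congr1 sA pA.
have [Pu _] : P \in unitmx /\ A *m P^T \in unitmx.
  by apply: mulmx1_unit; rewrite mulmxA.
(* A one-sided inverse of a square matrix is two-sided, so the left factor [P] may be moved to the
   right end. *)
have APP : A *m (P^T *m P) = 1%:M.
  by rewrite mulmxA; apply: mulmx1C; rewrite mulmxA.
have [Au _] := mulmx1_unit APP.
have -> : invmx A = P^T *m P by rewrite -(mulKmx Au (P^T *m P)) APP mulmx1.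
(* Cyclicity turns the trace into that of [P^T *m P *m B]; the symmetry of [P^T *m P] then matches
   the order of the indices. *)
have -> : \sum_i \sum_j (P^T *m P) i j * B i j = \tr (P *m B *m P^T).
  rewrite mxtrace_mulC mulmxA /mxtrace exchange_big /=.
  apply: eq_bigr => j _; rewrite !mxE; apply: eq_bigr => i _.
  rewrite !mxE; congr (_ * _); apply: eq_bigr => k _.
  by rewrite !mxE mulrC.
have pPBP i : 0 < (P *m B *m P^T) i i.
  by apply: posdefmx_diag_gt0; exact: posdefmx_congr.
(* Strictness comes from isolating one diagonal entry, which exists because [0 < n]. *)
rewrite /mxtrace (bigD1 (Ordinal n0)) //= ltr_wpDr //.
by apply: sumr_ge0 => i _; rewrite ltW.
Qed.

(** This is the trace of the metric with respect to itself: by symmetry the double sum is the trace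
    of [invmx A *m A]. *)
Lemma sum_invmx_mul (R : realType) (n : nat) (A : 'M[R]_n) :
  A^T = A -> A \in unitmx -> \sum_i \sum_j invmx A i j * A i j = n%:R.
Proof.
move=> sA Au; rewrite -(mxtrace1 R n) -(mulVmx Au).
apply: eq_bigr => i _; rewrite mxE; apply: eq_bigr => j _.
by congr (_ * _); rewrite -[in LHS]sA mxE.
Qed.

Lemma posdefmx_unit (R : realType) (n : nat) (A : 'M[R]_n) :
  A^T = A -> posdefmx A -> A \in unitmx.
Proof.
move=> sA pA; have [P] := posdefmx_congr1 sA pA.
by rewrite -mulmxA => /mulmx1_unit[_]; rewrite unitmx_mul => /andP[].
Qed.

Section ModifiedEinsteinTensor.
Context {R : realType} {n : nat} {M : smoothManifold R n}.
Variable g : riemannianMetric M.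

(** The metric has trace [n], and the trace of [Ric] is [Scal] by definition. *)
Lemma Ein_trace (k : R) (c : chart R n M) (p : M) : atlas c -> dom c p ->
  \sum_i \sum_j invmx (metric g c (Defs.coord c p)) i j * Ein g k c p i j =
  (n%:R - k) * Scal g c p.
Proof.
move=> ac dp; have ip : img c (Defs.coord c p) by exists p.
set G := metric g c (Defs.coord c p).
have sG : G^T = G by exact: (Defs.metric_sym g ac ip).
have Gu : G \in unitmx.
  by apply: posdefmx_unit => //; exact: (Defs.metric_pos g ac ip).
rewrite mulrBl -{1}(sum_invmx_mul sG Gu) {2}/Scal /scalar_curvature.
rewrite mulr_suml mulr_sumr -sumrB; apply: eq_bigr => i _.
rewrite mulr_suml mulr_sumr -sumrB; apply: eq_bigr => j _.
by rewrite /Ein /Ric -/G !mxE; ring.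
Qed.

Lemma Ein_gt0_Scal (k : R) : (0 < n)%N -> k < n%:R ->
  Ein_gt0 g k -> Scal_gt0 g.
Proof.
move=> n0 kn pE c p ac dp; have ip : img c (Defs.coord c p) by exists p.
have := posdefmx_trace_gt0 n0 (Defs.metric_sym g ac ip)
  (Defs.metric_pos g ac ip) (pE c p ac dp).
by rewrite Ein_trace // pmulr_rgt0 // subr_gt0.
Qed.

(** A factor [t] between 0 and 1 moves the constant towards 0 whatever its sign, so this form serves
    both halves of the theorem. *)
Lemma Ein_gt0_scale (k t : R) : (0 < n)%N -> k < n%:R -> 0 < t -> t < 1 ->
  Ein_gt0 g k -> Ein_gt0 g (t * k).
Proof.
move=> n0 kn t0 t1 pE c p ac dp; have ip : img c (Defs.coord c p) by exists p.
have S0 := Ein_gt0_Scal n0 kn pE ac dp.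
have -> : Ein g (t * k) c p =
    t *: Ein g k c p + ((1 - t) * Scal g c p) *: metric g c (Defs.coord c p).
  by rewrite /Ein; apply/matrixP => i j; rewrite !mxE; ring.
apply: posdefmx_comb => //; [|exact: pE|exact: (Defs.metric_pos g ac ip)].
by rewrite mulr_gt0 // subr_gt0.
Qed.

End ModifiedEinsteinTensor.

Theorem proposition1p1 (R : realType) (n : nat) (n_gt0 : (0 < n)%N)
    (M : smoothManifold R n) (g : riemannianMetric M) :
  (forall k l : R, 0 < k -> k < l -> l < n%:R ->
     (Ein_gt0 g l -> Ein_gt0 g k) /\ (Ein_gt0 g k -> Scal_gt0 g))
  /\
  (forall k l : R, k < l -> l < 0 ->
     (Ein_gt0 g k -> Ein_gt0 g l) /\ (Ein_gt0 g l -> Scal_gt0 g)).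
Proof.
split=> k l.
- move=> k0 kl ln; have l0 : 0 < l := lt_trans k0 kl.
  split; last by apply: Ein_gt0_Scal => //; exact: lt_trans ln.
  have -> : k = k / l * l by rewrite divfK ?gt_eqF.
  apply: Ein_gt0_scale => //; first exact: divr_gt0.
  by rewrite ltr_pdivrMr // mul1r.
- move=> kl l0; have k0 : k < 0 := lt_trans kl l0.
  have neg_ltn (x : R) : x < 0 -> x < n%:R by move/lt_le_trans; apply.
  split; last by apply: Ein_gt0_Scal => //; exact: neg_ltn.
  (* Both constants are negative and [l] is the closer to 0, so the ratio [l / k] lies strictly
     between 0 and 1. *)
  have -> : l = l / k * k by rewrite divfK ?lt_eqF.
  apply: Ein_gt0_scale => //; first exact: neg_ltn.
    by rewrite nmulr_lgt0 // invr_lt0.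
  by rewrite ltr_ndivrMr // mul1r.
Qed.
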